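(* Let $S=K\cup KbK\cup K\gamma_3K\subset\Gamma$, where $\gamma_3=bu^{-1}b$, and let $\mathcal F_S=\{x\in B(\mathbb C^2):d(0,x)\le d(g.0,x)\ \text{for all}\ g\in S\}$. Then the value of $r_0=\sup\{d(x,0):x\in\mathcal F_S\}$ is $$r_0=\tfrac12d(\gamma_3.0,0)=\tfrac12\cosh^{-1}(\sqrt3+1).$$
   Context: Let $\zeta=e^{2\pi i/12}$, $r=\zeta+\zeta^{-1}=\sqrt3$, and $$F=\begin{pmatrix}-r-1&1&0\\1&1-r&0\\0&0&1\end{pmatrix}.$$ Let $\Gamma=\{g\in M_{3\times3}(\mathbb Z[\zeta]):g^*Fg=F\}/Z$, where $g^*$ is the conjugate transpose of $g$ and $Z=\{\zeta^\nu I:\nu=0,1,\ldots,11\}$. Elements $gZ$ of $\Gamma$ are denoted by matrix representatives $g$. Action on the ball: let $B(\mathbb C^2)=\{(z_1,z_2)\in\mathbb C^2:|z_1|^2+|z_2|^2<1\}$, with origin denoted $0$ and with the hyperbolic metric $d$ given by $$\cosh^2(d(z,w))=\frac{|1-\langle z,w\rangle|^2}{(1-|z|^2)(1-|w|^2)},\quad \langle z,w\rangle=z_1\bar w_1+z_2\bar w_2,\quad |z|^2=\langle z,z\rangle.$$ Let $$\gamma_0=\begin{pmatrix}1&0&0\\1&1-r&0\\0&0&1\end{pmatrix},\qquad D=\mathrm{diag}\bigl(1,1,\sqrt{\sqrt3-1}\bigr),$$ and $\tilde g=D\gamma_0g\gamma_0^{-1}D^{-1}$, which is unitary with respect to $\mathrm{diag}(1,1,-1)$.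 Then $(gZ).(z,w)=(z',w')$ if $\tilde g(z,w,1)^T=\lambda(z',w',1)^T$ for some $\lambda\in\mathbb C$; one writes $g.0$ for $(gZ).(0,0)$. The following matrices define elements of $\Gamma$: $$u=\begin{pmatrix}\zeta^3+\zeta^2-\zeta&1-\zeta&0\\ \zeta^3+\zeta^2-1&\zeta-\zeta^3&0\\0&0&1\end{pmatrix},\quad v=\begin{pmatrix}\zeta^3&0&0\\ \zeta^3+\zeta^2-\zeta-1&1&0\\0&0&1\end{pmatrix},$$ $$b=\begin{pmatrix}1&0&0\\-2\zeta^3-\zeta^2+2\zeta+2&\zeta^3+\zeta^2-\zeta-1&-\zeta^3-\zeta^2\\ \zeta^2+\zeta&-\zeta^3-1&-\zeta^3+\zeta+1\end{pmatrix}.$$ $K$ is the subgroup of $\Gamma$ generated by $u$ and $v$ (it has order $288$). *)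

(* Defs.v *)
From HB Require Import structures.
From mathcomp Require Import all_boot all_order all_algebra.
From mathcomp Require Import generic_quotient complex spectral sesquilinear.
From mathcomp Require Import ring lra.
From mathcomp Require Import all_classical all_reals all_analysis.

Set Implicit Arguments.
Unset Strict Implicit.
Unset Printing Implicit Defensive.

Import Order.TTheory GRing.Theory Num.Theory.

Local Open Scope classical_set_scope.
Local Open Scope quotient_scope.
Local Open Scope complex_scope.
Local Open Scope sesquilinear_scope.
Local Open Scope ring_scope.

Local Ltac entrywise := apply/matrixP; move=> [[|[|[|//]]] ?] [[|[|[|//]]] ?];
  rewrite ?mxE ?big_ord_recl ?big_ord0 ?mxE ?big_ord_recl ?big_ord0 ?mxE /=.

Section Zeta.
Context {R : realType}.
Local Notation C := R[i].

Definition zeta : C := cos (2 * pi / 12) +i* sin (2 * pi / 12).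
Definition rr : C := zeta + zeta^-1.

Lemma zeta_cis : zeta = cos (pi / 6) +i* sin (pi / 6).
Proof. by have -> : pi / 6 = 2 * pi / 12 :> R by field. Qed.

Lemma cos_pi6 : cos (pi / 6 : R) = Num.sqrt 3 / 2.
Proof.
have c0 : 0 < cos (pi / 6 : R).
  by apply: cos_gt0_pihalf; have := pi_gt0 R => ?; apply/andP; split; lra.
have s0 : 0 < sin (pi / 6 : R).
  by apply: sin_gt0_pi; have := pi_gt0 R => ?; apply/andP; split; lra.
have E := cos2Dsin2 (pi / 6 : R).
have E3 : cos (pi / 6 + (pi / 6 + pi / 6) : R) = 0.
  have -> : pi / 6 + (pi / 6 + pi / 6) = pi / 2 :> R by field.
  exact: cos_pihalf.
rewrite cosD cosD sinD in E3.
set c := cos _ in c0 E E3 *; set s := sin _ in s0 E E3.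
have c2 : c ^+ 2 = (Num.sqrt 3 / 2) ^+ 2.
  rewrite expr_div_n sqr_sqrtr ?ler0n //.
  have : c * (4 * c ^+ 2 - 3) = 0.
    transitivity (c * (c * c - s * s) - s * (s * c + c * s)
       + 3 * c * (c ^+ 2 + s ^+ 2 - 1)); first by ring.
    by rewrite E3 E; ring.
  by move/eqP; rewrite mulf_eq0 (gt_eqF c0) /= => /eqP H; lra.
by apply/eqP; rewrite -(eqrXn2 (n := 2)) ?c2 // ?ltW // divr_ge0 ?sqrtr_ge0.
Qed.

Lemma sin_pi6 : sin (pi / 6 : R) = 1 / 2.
Proof.
have s0 : 0 < sin (pi / 6 : R).
  by apply: sin_gt0_pi; have := pi_gt0 R => ?; apply/andP; split; lra.
have := cos2Dsin2 (pi / 6 : R); rewrite cos_pi6 expr_div_n sqr_sqrtr // => E.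
by apply/eqP; rewrite -(eqrXn2 (n := 2)) // ?ltW //; apply/eqP; lra.
Qed.

Lemma zetaE : zeta = (Num.sqrt 3 / 2) +i* (1 / 2).
Proof. by rewrite zeta_cis cos_pi6 sin_pi6. Qed.

Lemma zeta4 : zeta ^+ 4 = zeta ^+ 2 - 1.
Proof.
have s3 : Num.sqrt 3 ^+ 2 = 3 :> R by rewrite sqr_sqrtr.
have z2 : zeta ^+ 2 = (1 / 2) +i* (Num.sqrt 3 / 2).
  rewrite zetaE expr2; simpc; congr (_ +i* _); last by field.
  by transitivity (Num.sqrt 3 ^+ 2 / 4 - 1 / 4 : R); [field|rewrite s3; field].
rewrite (exprM _ 2 2) z2 expr2; simpc; congr (_ +i* _); last by field.
by transitivity (1 / 4 - Num.sqrt 3 ^+ 2 / 4 : R); [field|rewrite s3; field].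
Qed.

Lemma zetaVE : zeta^-1 = zeta - zeta ^+ 3.
Proof.
have E : zeta * (zeta - zeta ^+ 3) = 1.
  by transitivity (zeta ^+ 2 - zeta ^+ 4); [ring|rewrite zeta4; ring].
have z0 : zeta != 0 by apply: contra_eq_neq E => ->; rewrite mul0r eq_sym oner_neq0.
by apply: (mulfI z0); rewrite mulfV.
Qed.

Lemma conj_zeta : zeta^* = zeta^-1.
Proof.
have s3 : Num.sqrt 3 ^+ 2 = 3 :> R by rewrite sqr_sqrtr.
have E : zeta^* * zeta = 1.
  rewrite zetaE; simpc; congr (_ +i* _); last by field.
  by transitivity (Num.sqrt 3 ^+ 2 / 4 + 1 / 4 : R); [field|rewrite s3; field].
have z0 : zeta != 0 by apply: contra_eq_neq E => ->; rewrite mulr0 eq_sym oner_neq0.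
by apply: (mulIf z0); rewrite mulVf.
Qed.

Lemma rr_zeta : rr = 2 * zeta - zeta ^+ 3.
Proof. by rewrite /rr zetaVE; ring. Qed.

Lemma rrE : rr = (Num.sqrt 3)%:C.
Proof. by rewrite /rr -conj_zeta zetaE; simpc; congr (_ +i* _); field. Qed.

Lemma conj_rr : rr^* = rr.
Proof. by rewrite rrE; simpc. Qed.

Lemma zeta12 : zeta ^+ 12 = 1.
Proof. ring: zeta4. Qed.

Definition Zzeta : {pred C} :=
  fun x => `[< exists p : {poly int}, x = (map_poly intr p).[zeta] >].

Lemma Zzeta_subring : subring_closed Zzeta.
Proof.
split; first by apply/asboolP; exists 1; rewrite rmorph1 hornerC.
- move=> _ _ /asboolP[p ->] /asboolP[q ->]; apply/asboolP; exists (p - q).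
  by rewrite rmorphB /= hornerD hornerN.
- move=> _ _ /asboolP[p ->] /asboolP[q ->]; apply/asboolP; exists (p * q).
  by rewrite rmorphM /= hornerM.
Qed.
HB.instance Definition _ := GRing.isSubringClosed.Build C Zzeta Zzeta_subring.

Lemma zeta_Zzeta : zeta \in Zzeta.
Proof. by apply/asboolP; exists 'X; rewrite map_polyX hornerX. Qed.

Lemma zetaV_Zzeta : zeta^-1 \in Zzeta.
Proof. by rewrite zetaVE rpredB ?rpredX ?zeta_Zzeta. Qed.

Lemma rr_Zzeta : rr \in Zzeta.
Proof. by rewrite rpredD ?zeta_Zzeta ?zetaV_Zzeta. Qed.

Lemma conj_Zzeta x : x \in Zzeta -> x^* \in Zzeta.
Proof.
move=> /asboolP[p ->].
have -> : ((map_poly intr p).[zeta])^* = (map_poly intr p).[zeta^*] :> C.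
  rewrite -horner_map -map_poly_comp; congr horner; apply: eq_map_poly => n /=.
  by rewrite rmorph_int.
apply: rpred_horner; last by rewrite conj_zeta zetaV_Zzeta.
by apply/polyOverP => i; rewrite coef_map rpred_int.
Qed.

Definition mx3 (s : seq (seq C)) : 'M[C]_3 :=
  \matrix_(i, j) (nth [::] s i)`_j.

Definition formF : 'M[C]_3 :=
  mx3 [:: [:: - rr - 1; 1;      0];
          [:: 1;        1 - rr; 0];
          [:: 0;        0;      1]].

Definition unitaryF : {pred 'M[C]_3} :=
  [pred g | (g \is a mxOver Zzeta) && (g^t* *m formF *m g == formF)].

Definition u_mx : 'M[C]_3 :=
  mx3 [:: [:: zeta ^+ 3 + zeta ^+ 2 - zeta; 1 - zeta;         0];
          [:: zeta ^+ 3 + zeta ^+ 2 - 1;    zeta - zeta ^+ 3; 0];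
          [:: 0;                            0;                1]].

Definition v_mx : 'M[C]_3 :=
  mx3 [:: [:: zeta ^+ 3;                            0; 0];
          [:: zeta ^+ 3 + zeta ^+ 2 - zeta - 1;     1; 0];
          [:: 0;                                    0; 1]].

Definition b_mx : 'M[C]_3 :=
  mx3 [:: [:: 1; 0; 0];
          [:: - 2 * zeta ^+ 3 - zeta ^+ 2 + 2 * zeta + 2;
              zeta ^+ 3 + zeta ^+ 2 - zeta - 1;
              - zeta ^+ 3 - zeta ^+ 2];
          [:: zeta ^+ 2 + zeta;
              - zeta ^+ 3 - 1;
              - zeta ^+ 3 + zeta + 1]].

Lemma mx3_Zzeta s : all (all [in Zzeta]) s -> mx3 s \is a mxOver Zzeta.
Proof.
move=> /allP sZ; apply/mxOverP => i j; rewrite mxE.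
have [js|js] := ltnP j (size (nth [::] s i)); last by rewrite nth_default ?rpred0.
have [si|si] := ltnP i (size s); last by rewrite (nth_default _ si) nth_nil rpred0.
by apply: (allP (sZ _ (mem_nth _ si))); apply: mem_nth.
Qed.

Local Ltac zring := rewrite /= ?(rpredD, rpredN, rpredM, rpredX, rpred_nat, rpred0,
  rpred1, zeta_Zzeta, zetaV_Zzeta, rr_Zzeta) //.

Lemma F_Zzeta : formF \is a mxOver Zzeta.
Proof. by apply: mx3_Zzeta; zring. Qed.

Local Ltac Fring := entrywise;
  rewrite ?(rmorphD, rmorphN, rmorphB, rmorphM, rmorphXn, rmorph_nat, rmorph1, rmorph0) /=
    ?conj_zeta ?zetaVE ?rr_zeta /=; ring: zeta4.

Lemma u_unitaryF : u_mx \in unitaryF.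
Proof.
apply/andP; split; first by apply: mx3_Zzeta; zring.
apply/eqP; Fring.
Qed.

Lemma v_unitaryF : v_mx \in unitaryF.
Proof.
apply/andP; split; first by apply: mx3_Zzeta; zring.
apply/eqP; Fring.
Qed.

Lemma b_unitaryF : b_mx \in unitaryF.
Proof.
apply/andP; split; first by apply: mx3_Zzeta; zring.
apply/eqP; Fring.
Qed.

Definition invF : 'M[C]_3 :=
  mx3 [:: [:: 1 - rr; - 1;      0];
          [:: - 1;    - rr - 1; 0];
          [:: 0;      0;        1]].

Lemma mul_invF : invF *m formF = 1%:M.
Proof. Fring. Qed.

Lemma invF_Zzeta : invF \is a mxOver Zzeta.
Proof. by apply: mx3_Zzeta; zring. Qed.

Lemma adjmxM m n p (A : 'M[C]_(m, n)) (B : 'M[C]_(n, p)) :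
  (A *m B)^t* = B^t* *m A^t*.
Proof. by rewrite trmx_mul map_mxM. Qed.

Lemma unitaryF_inv g : g \in unitaryF ->
  g \in unitmx /\ invmx g = invF *m g^t* *m formF.
Proof.
move=> /andP[_ /eqP gF].
have E : (invF *m g^t* *m formF) *m g = 1%:M.
  by rewrite -!mulmxA [_ *m (formF *m g)]mulmxA gF mul_invF.
have ug := (mulmx1_unit E).2; split=> //.
by rewrite -[LHS]mul1mx -E mulmxK.
Qed.

Lemma unitaryF1 : 1%:M \in unitaryF.
Proof.
apply/andP; split; last by rewrite trmx1 map_mx1 mul1mx mulmx1.
by apply/mxOverP => i j; rewrite mxE rpredMn ?rpred1.
Qed.

Lemma unitaryFM g h : g \in unitaryF -> h \in unitaryF -> g *m h \in unitaryF.
Proof.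
move=> /andP[gZ /eqP gF] /andP[hZ /eqP hF]; apply/andP; split.
  exact: mxOverM.
have -> : (g *m h)^t* *m formF *m (g *m h) = h^t* *m (g^t* *m formF *m g) *m h.
  by rewrite adjmxM !mulmxA.
by rewrite gF hF.
Qed.

Lemma unitaryFV g : g \in unitaryF -> invmx g \in unitaryF.
Proof.
move=> gU; have /andP[gZ /eqP gF] := gU; have [ug Eg] := unitaryF_inv gU.
apply/andP; split.
  rewrite Eg !mxOverM ?invF_Zzeta ?F_Zzeta //.
  by apply/mxOverP => i j; rewrite !mxE conj_Zzeta //; apply: (mxOverP gZ).
have E : (invmx g)^t* *m g^t* = 1%:M.
  by rewrite -adjmxM mulmxV // trmx1 map_mx1.
by rewrite -{1}gF -!mulmxA mulmxV // mulmx1 !mulmxA E mul1mx.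
Qed.

End Zeta.

Record isomF (R : realType) :=
  IsomF { isomF_val :> 'M[R[i]]_3; isomF_prop : isomF_val \in unitaryF }.

Section IsomF.
Variable R : realType.
Implicit Types g h k : isomF R.

HB.instance Definition _ := [isSub for @isomF_val R].
HB.instance Definition _ := [Choice of isomF R by <:].

Definition isomF_one := IsomF (@unitaryF1 R).
Definition isomF_mul g h := IsomF (unitaryFM (isomF_prop g) (isomF_prop h)).
Definition isomF_inv g := IsomF (unitaryFV (isomF_prop g)).

Fact isomF_mulA : associative isomF_mul.
Proof. by move=> g h k; apply/val_inj/mulmxA. Qed.
Fact isomF_mul1 : left_id isomF_one isomF_mul.
Proof. by move=> g; apply/val_inj/mul1mx. Qed.
Fact isomF_1mul : right_id isomF_one isomF_mul.
Proof. by move=> g; apply/val_inj/mulmx1. Qed.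
Fact isomF_mulV : left_inverse isomF_one isomF_inv isomF_mul.
Proof.
by move=> g; apply/val_inj/mulVmx; have [] := unitaryF_inv (isomF_prop g).
Qed.
Fact isomF_Vmul : right_inverse isomF_one isomF_inv isomF_mul.
Proof.
by move=> g; apply/val_inj/mulmxV; have [] := unitaryF_inv (isomF_prop g).
Qed.

HB.instance Definition _ := isGroup.Build (isomF R)
  isomF_mulA isomF_mul1 isomF_1mul isomF_mulV isomF_Vmul.

(* g and h differ by an element zeta ^+ nu * I of Z. *)
Definition eqmodZ g h := [exists nu : 'I_12, val h == zeta ^+ nu *: val g].

Lemma eqmodZP g h :
  reflect (exists n : nat, val h = zeta ^+ n *: val g) (eqmodZ g h).
Proof.
apply: (iffP existsP) => [[nu /eqP ->]|[n ->]]; first by exists nu.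
by exists (inord (n %% 12)); rewrite inordK ?ltn_mod // expr_mod // zeta12.
Qed.

Lemma eqmodZ_refl : reflexive eqmodZ.
Proof. by move=> g; apply/eqmodZP; exists 0%N; rewrite scale1r. Qed.

Lemma eqmodZ_trans : transitive eqmodZ.
Proof.
move=> h g k /eqmodZP[m gh] /eqmodZP[n hk]; apply/eqmodZP; exists (n + m)%N.
by rewrite hk gh scalerA exprD.
Qed.

Lemma eqmodZ_sym : symmetric eqmodZ.
Proof.
suff s g h : eqmodZ g h -> eqmodZ h g by move=> g h; apply/idP/idP; apply: s.
move=> /existsP[nu /eqP gh]; apply/eqmodZP; exists (12 - nu)%N.
by rewrite gh scalerA -exprD subnK ?zeta12 ?scale1r // ltnW.
Qed.

Canonical eqmodZ_equiv :=
  EquivRel eqmodZ eqmodZ_refl eqmodZ_sym eqmodZ_trans.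

Definition Gamma := {eq_quot eqmodZ}.
HB.instance Definition _ := Choice.on Gamma.
HB.instance Definition _ := EqQuotient.on Gamma.

Definition coset_Z g : Gamma := \pi_Gamma g.

Lemma coset_ZP g h : coset_Z g = coset_Z h <-> eqmodZ g h.
Proof. by split=> [/eqquotP|?] //; apply/eqquotP. Qed.

Lemma coset_Z_repr (a : Gamma) : coset_Z (repr a) = a.
Proof. exact: reprK. Qed.

Lemma eqmodZ_repr g : eqmodZ (repr (coset_Z g)) g.
Proof. by apply/coset_ZP; rewrite coset_Z_repr. Qed.

Lemma eqmodZM g g' h h' :
  eqmodZ g g' -> eqmodZ h h' -> eqmodZ (g * h)%g (g' * h')%g.
Proof.
move=> /eqmodZP[m gm] /eqmodZP[n hn]; apply/eqmodZP; exists (m + n)%N => /=.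
by rewrite gm hn -scalemxAl -scalemxAr scalerA exprD.
Qed.

Lemma eqmodZV g h : eqmodZ g h -> eqmodZ g^-1%g h^-1%g.
Proof.
move=> gh; have E := eqmodZM (eqmodZM (eqmodZ_refl g^-1%g) gh) (eqmodZ_refl h^-1%g).
by rewrite mulVg mul1g mulgK in E; rewrite eqmodZ_sym.
Qed.

Definition Gamma_one : Gamma := coset_Z 1%g.
Definition Gamma_mul (a b : Gamma) : Gamma := coset_Z (repr a * repr b)%g.
Definition Gamma_inv (a : Gamma) : Gamma := coset_Z (repr a)^-1%g.

Fact Gamma_mulE g h : Gamma_mul (coset_Z g) (coset_Z h) = coset_Z (g * h)%g.
Proof. by apply/coset_ZP/eqmodZM; apply: eqmodZ_repr. Qed.
Fact Gamma_invE g : Gamma_inv (coset_Z g) = coset_Z g^-1%g.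
Proof. by apply/coset_ZP/eqmodZV/eqmodZ_repr. Qed.

Fact Gamma_mulA : associative Gamma_mul.
Proof.
move=> a b c; rewrite -(coset_Z_repr a) -(coset_Z_repr b) -(coset_Z_repr c).
by rewrite !Gamma_mulE mulgA.
Qed.
Fact Gamma_mul1 : left_id Gamma_one Gamma_mul.
Proof. by move=> a; rewrite -(coset_Z_repr a) Gamma_mulE mul1g. Qed.
Fact Gamma_1mul : right_id Gamma_one Gamma_mul.
Proof. by move=> a; rewrite -(coset_Z_repr a) Gamma_mulE mulg1. Qed.
Fact Gamma_mulV : left_inverse Gamma_one Gamma_inv Gamma_mul.
Proof. by move=> a; rewrite -(coset_Z_repr a) Gamma_invE Gamma_mulE mulVg. Qed.
Fact Gamma_Vmul : right_inverse Gamma_one Gamma_inv Gamma_mul.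
Proof. by move=> a; rewrite -(coset_Z_repr a) Gamma_invE Gamma_mulE mulgV. Qed.

HB.instance Definition _ := isGroup.Build Gamma
  Gamma_mulA Gamma_mul1 Gamma_1mul Gamma_mulV Gamma_Vmul.

Lemma coset_ZM g h : coset_Z (g * h)%g = (coset_Z g * coset_Z h)%g.
Proof. exact/esym/Gamma_mulE. Qed.

Lemma coset_ZV g : coset_Z g^-1%g = (coset_Z g)^-1%g.
Proof. exact/esym/Gamma_invE. Qed.

End IsomF.

Section Ball.
Context {R : realType}.
Local Notation C := R[i].
Local Notation C2 := (C * C)%type.

Definition herm (x y : C2) : C := x.1 * y.1^* + x.2 * y.2^*.

Definition sqnorm (x : C2) : R := complex.Re (herm x x).

Definition unit_ball : set C2 := [set x | sqnorm x < 1].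

Definition cosh (t : R) : R := (expR t + expR (- t)) / 2.

(* The nonnegative inverse of cosh on [1, +oo[. *)
Definition arcosh (y : R) : R := ln (y + Num.sqrt (y ^+ 2 - 1)).

Definition hdist (x y : C2) : R :=
  arcosh (Normc.normc (1 - herm x y)
          / Num.sqrt ((1 - sqnorm x) * (1 - sqnorm y))).

Lemma arcosh_ge0 y : 1 <= y -> 0 <= arcosh y.
Proof.
by move=> y1; apply: ln_ge0; have := sqrtr_ge0 (y ^+ 2 - 1); lra.
Qed.

Lemma arcoshK y : 1 <= y -> cosh (arcosh y) = y.
Proof.
move=> y1; set s := Num.sqrt (y ^+ 2 - 1).
have s0 : 0 <= s by apply: sqrtr_ge0.
have s2 : s ^+ 2 = y ^+ 2 - 1 by rewrite sqr_sqrtr // subr_ge0 expr_ge1 //; lra.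
have p : 0 < y + s by lra.
rewrite /cosh /arcosh -/s expRN lnK ?posrE //.
have -> : (y + s)^-1 = y - s.
  apply: (mulfI (lt0r_neq0 p)); rewrite mulfV ?lt0r_neq0 //.
  by transitivity (y ^+ 2 - s ^+ 2); [rewrite s2; ring|ring].
by field.
Qed.

Lemma sqr_normc (z : C) : Normc.normc z ^+ 2 = complex.Re z ^+ 2 + complex.Im z ^+ 2.
Proof. by case: z => a b /=; rewrite sqr_sqrtr ?addr_ge0 ?sqr_ge0. Qed.

Lemma sqnormE (x : C2) :
  sqnorm x = Normc.normc x.1 ^+ 2 + Normc.normc x.2 ^+ 2.
Proof.
rewrite !sqr_normc; case: x => -[a b] [c d].
by rewrite /sqnorm /herm /= -!expr2; ring.
Qed.

Lemma hdist_ball (x y : C2) : unit_ball x -> unit_ball y ->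
  0 < (1 - sqnorm x) * (1 - sqnorm y) <= Normc.normc (1 - herm x y) ^+ 2.
Proof.
move=> bx by_; apply/andP; split.
  by rewrite mulr_gt0 // subr_gt0.
have -> : Normc.normc (1 - herm x y) ^+ 2 = (1 - sqnorm x) * (1 - sqnorm y)
    + sqnorm (x - y) * (1 - sqnorm x) + Normc.normc (herm (x - y) x) ^+ 2.
  rewrite !sqr_normc !sqnormE !sqr_normc.
  case: x y {bx by_} => -[a b] [c d] [[a' b'] [c' d']] /=; ring.
rewrite -addrA lerDl addr_ge0 ?sqr_ge0 // mulr_ge0 ?(ltW (_ : 0 < 1 - sqnorm x)) //.
  by rewrite sqnormE addr_ge0 ?sqr_ge0.
by rewrite subr_gt0.
Qed.

Lemma hdist_ge0 (x y : C2) : unit_ball x -> unit_ball y -> 0 <= hdist x y.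
Proof.
move=> bx by_; have /andP[p le] := hdist_ball bx by_.
apply: arcosh_ge0; rewrite ler_pdivlMr ?sqrtr_gt0 // mul1r.
rewrite -(ler_pXn2r (ltn0Sn 1)) ?nnegrE ?sqrtr_ge0 //; last first.
  by case: (1 - herm x y) => ? ? /=; rewrite sqrtr_ge0.
by rewrite sqr_sqrtr // ltW.
Qed.

Lemma cosh_hdist (x y : C2) : unit_ball x -> unit_ball y ->
  cosh (hdist x y) ^+ 2 =
  Normc.normc (1 - herm x y) ^+ 2 / ((1 - sqnorm x) * (1 - sqnorm y)).
Proof.
move=> bx by_; have /andP[p le] := hdist_ball bx by_.
rewrite arcoshK; first by rewrite expr_div_n sqr_sqrtr // ltW.
rewrite ler_pdivlMr ?sqrtr_gt0 // mul1r.
rewrite -(ler_pXn2r (ltn0Sn 1)) ?nnegrE ?sqrtr_ge0 //; last first.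
  by case: (1 - herm x y) => ? ? /=; rewrite sqrtr_ge0.
by rewrite sqr_sqrtr // ltW.
Qed.

Definition gamma0 : 'M[C]_3 :=
  mx3 [:: [:: 1; 0;      0];
          [:: 1; 1 - rr; 0];
          [:: 0; 0;      1]].

Definition diagD : 'M[C]_3 :=
  mx3 [:: [:: 1; 0; 0];
          [:: 0; 1; 0];
          [:: 0; 0; (Num.sqrt (Num.sqrt 3 - 1))%:C]].

Definition formJ : 'M[C]_3 :=
  mx3 [:: [:: 1; 0; 0]; [:: 0; 1; 0]; [:: 0; 0; - 1]].

Definition tilde (g : 'M[C]_3) : 'M[C]_3 :=
  diagD *m gamma0 *m g *m invmx gamma0 *m invmx diagD.

Definition hcol (x : C2) : 'cV[C]_3 := \col_i [:: x.1; x.2; 1]`_i.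

Definition mact (g : 'M[C]_3) (x : C2) : C2 :=
  let y := tilde g *m hcol x in (y 0 0 / y 2 0, y 1 0 / y 2 0).

Definition act (a : Gamma R) (x : C2) : C2 := mact (val (repr a)) x.

Lemma rr_neq1 : 1 - rr != 0 :> C.
Proof.
apply/eqP => E; have : rr ^+ 2 = 1 :> C by rewrite -[rr](subKr 1) E subr0 expr1n.
rewrite rrE -rmorphXn /= sqr_sqrtr // => /(congr1 (@complex.Re R)) /=.
by move=> E3; have : (3 : R) = 1 by []; lra.
Qed.

Lemma sqrtD_gt0 : 0 < Num.sqrt (Num.sqrt 3 - 1) :> R.
Proof. by rewrite sqrtr_gt0 subr_gt0 -{1}sqrtr1 ltr_sqrt; lra. Qed.

Lemma sqr_sqrtD : (Num.sqrt (Num.sqrt 3 - 1))%:C ^+ 2 = rr - 1 :> C.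
Proof.
have := sqrtD_gt0; rewrite sqrtr_gt0 => /ltW d0.
by rewrite rrE -rmorphXn /= sqr_sqrtr // rmorphB rmorph1.
Qed.

Lemma unitmx_gamma0 : gamma0 \in unitmx.
Proof.
suff /mulmx1_unit[] : gamma0 *m mx3 [:: [:: 1; 0; 0];
  [:: - (1 - rr)^-1; (1 - rr)^-1; 0]; [:: 0; 0; 1]] = 1%:M by [].
by have r0 := rr_neq1; entrywise; field.
Qed.

Lemma unitmx_D : diagD \in unitmx.
Proof.
have d0 : (Num.sqrt (Num.sqrt 3 - 1))%:C != 0 :> C.
  by rewrite fmorph_eq0 gt_eqF ?sqrtD_gt0.
suff /mulmx1_unit[] : diagD *m mx3 [:: [:: 1; 0; 0]; [:: 0; 1; 0];
  [:: 0; 0; ((Num.sqrt (Num.sqrt 3 - 1))%:C)^-1]] = 1%:M by [].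
by entrywise; field.
Qed.

Lemma gamma0_J : (diagD *m gamma0)^t* *m formJ *m (diagD *m gamma0) = (1 - rr) *: formF.
Proof.
have r2 : rr ^+ 2 = 3 :> C by rewrite rrE -rmorphXn /= sqr_sqrtr // rmorph_nat.
have cr : rr^* = rr :> C := conj_rr; have d2 := sqr_sqrtD.
have cd : ((Num.sqrt (Num.sqrt 3 - 1))%:C)^* = (Num.sqrt (Num.sqrt 3 - 1))%:C :> C.
  by simpc.
rewrite /diagD /gamma0 /formF.
move: (Num.sqrt _)%:C rr r2 d2 cd cr => d r r2 d2 cd cr.
have -> : (mx3 [:: [:: 1; 0; 0]; [:: 0; 1; 0]; [:: 0; 0; d]]
    *m mx3 [:: [:: 1; 0; 0]; [:: 1; 1 - r; 0]; [:: 0; 0; 1]])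
  = mx3 [:: [:: 1; 0; 0]; [:: 1; 1 - r; 0]; [:: 0; 0; d]].
  by entrywise; ring.
entrywise; rewrite ?(rmorphB, rmorph1, rmorph0) /= ?cd ?cr; ring: r2 d2.
Qed.

Lemma isometry_conj (A B T g h : 'M[C]_3) : T \in unitmx ->
  h *m T = T *m g -> T^t* *m A *m T = B -> g^t* *m B *m g = B ->
  h^t* *m A *m h = A.
Proof.
move=> uT hT TA gB.
have uT' : T^t* \in unitmx by rewrite map_unitmx unitmx_tr.
apply: (can_inj (mulmxK uT)); apply: (can_inj (mulKmx uT')).
transitivity ((h *m T)^t* *m A *m (h *m T)); first by rewrite adjmxM !mulmxA.
rewrite hT [RHS]mulmxA TA -[RHS]gB -TA adjmxM.
by rewrite !mulmxA.
Qed.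

Lemma conj_mxM (a b g h : 'M[C]_3) : a \in unitmx -> b \in unitmx ->
  b *m a *m (g *m h) *m invmx a *m invmx b =
  b *m a *m g *m invmx a *m invmx b *m (b *m a *m h *m invmx a *m invmx b).
Proof. by move=> ua ub; rewrite -!mulmxA (mulKmx ub) (mulKmx ua). Qed.

Lemma conj_mx_comm (a b g : 'M[C]_3) : a \in unitmx -> b \in unitmx ->
  b *m a *m g *m invmx a *m invmx b *m (b *m a) = b *m a *m g.
Proof. by move=> ua ub; rewrite !mulmxA mulmxKV // mulmxKV. Qed.

Lemma form_mulmx (A g : 'M[C]_3) (w : 'cV[C]_3) :
  (g *m w)^t* *m A *m (g *m w) = w^t* *m (g^t* *m A *m g) *m w.
Proof. by rewrite adjmxM !mulmxA. Qed.

Lemma tilde_unitary (g : 'M[C]_3) :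
  g \in unitaryF -> (tilde g)^t* *m formJ *m tilde g = formJ.
Proof.
move=> /andP[_ /eqP gF].
apply: (isometry_conj _ _ gamma0_J).
- by rewrite unitmx_mul unitmx_D unitmx_gamma0.
- exact: conj_mx_comm unitmx_gamma0 unitmx_D.
- by rewrite -scalemxAr -scalemxAl gF.
Qed.

Lemma J_form (w : 'cV[C]_3) : (w^t* *m formJ *m w) 0 0 =
  (Normc.normc (w 0 0) ^+ 2 + Normc.normc (w 1 0) ^+ 2
     - Normc.normc (w 2 0) ^+ 2)%:C.
Proof.
rewrite !sqr_normc !mxE !big_ord_recl !big_ord0 !mxE !big_ord_recl !big_ord0 !mxE /=.
rewrite (_ : lift ord0 ord0 = 1) 1?(_ : lift ord0 (lift ord0 ord0) = 2);
  try exact/val_inj.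
case: (w 0 0) (w 1 0) (w 2 0) => [x0 y0] [x1 y1] [x2 y2]; simpc.
by congr (_ +i* _) => /=; ring.
Qed.

Lemma tilde_sqnorm (g : 'M[C]_3) (x : C2) : g \in unitaryF ->
  let y := tilde g *m hcol x in
  Normc.normc (y 0 0) ^+ 2 + Normc.normc (y 1 0) ^+ 2
    - Normc.normc (y 2 0) ^+ 2 = sqnorm x - 1.
Proof.
move=> gU y.
have E : y^t* *m formJ *m y = (hcol x)^t* *m formJ *m hcol x.
  by rewrite /y form_mulmx tilde_unitary.
have := congr1 (fun M : 'M[C]_1 => M 0 0) E.
rewrite !J_form => /complexI ->; rewrite sqnormE /hcol 3!mxE.
by congr (_ - _); rewrite sqr_normc /= expr1n expr0n addr0.
Qed.

Lemma tilde_neq0 (g : 'M[C]_3) (x : C2) : g \in unitaryF -> unit_ball x ->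
  (tilde g *m hcol x) 2 0 != 0.
Proof.
move=> gU xB; apply/eqP => y0; have := tilde_sqnorm x gU; rewrite /= y0.
have -> : Normc.normc (0 : C) ^+ 2 = 0 by rewrite sqr_normc /= expr0n addr0.
set y := _ *m _; move: xB; rewrite /unit_ball /=.
have := sqr_ge0 (Normc.normc (y 0 0)); have := sqr_ge0 (Normc.normc (y 1 0)).
by lra.
Qed.

(* mact is the projective action of tilde g on the points [z : w : 1]. *)
Lemma mactP (g : 'M[C]_3) (x y : C2) : g \in unitaryF -> unit_ball x ->
  mact g x = y <-> exists l : C, tilde g *m hcol x = l *: hcol y.
Proof.
move=> gU xB; have t0 := tilde_neq0 gU xB; split=> [<-|[l E]].
  exists ((tilde g *m hcol x) 2 0); rewrite /mact.
  move: (tilde g *m hcol x) t0 => t t0; apply/matrixP => i j.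
  rewrite ord1 {j} !mxE; case: i => [[|[|[|//]]] ?] /=;
    rewrite ?mulr1 1?mulrC ?divfK //; congr (t _ _); exact/val_inj.
move: t0; rewrite /mact E !mxE /= mulr1 => l0.
by rewrite !(mulrC l) !mulfK //; case: (y).
Qed.

Lemma tildeM (g h : 'M[C]_3) : tilde (g *m h) = tilde g *m tilde h.
Proof. exact: conj_mxM unitmx_gamma0 unitmx_D. Qed.

Lemma mact_ball (g : 'M[C]_3) (x : C2) :
  g \in unitaryF -> unit_ball x -> unit_ball (mact g x).
Proof.
move=> gU xB; have t0 := tilde_neq0 gU xB; have := tilde_sqnorm x gU.
move: xB; rewrite /mact /=; set y := tilde g *m hcol x in t0 *.
rewrite /unit_ball /= => xB E; rewrite sqnormE [X in X < _]/=.
rewrite !Normc.normcM !Normc.normcV.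
have y2 : 0 < Normc.normc (y 2 0) ^+ 2.
  rewrite exprn_gt0 // lt0r; apply/andP; split.
    by apply: contra t0 => /eqP /Normc.eq0_normc ->.
  by case: (y 2 0) => ? ? /=; rewrite sqrtr_ge0.
by rewrite !exprMn !exprVn -mulrDl ltr_pdivrMr // mul1r; lra.
Qed.

Lemma mactM (g h : 'M[C]_3) (x : C2) : g \in unitaryF -> h \in unitaryF -> unit_ball x ->
  mact (g *m h) x = mact g (mact h x).
Proof.
move=> gU hU xB; have hB := mact_ball hU xB.
have [l E] := (mactP (mact h x) hU xB).1 erefl.
have [m E'] := (mactP (mact g (mact h x)) gU hB).1 erefl.
apply/mactP => //; first exact: unitaryFM.
exists (l * m); rewrite tildeM -[RHS]scalerA -E' scalemxAr -E.
exact/esym/mulmxA.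
Qed.

Lemma mactZ (c : C) (g : 'M[C]_3) (x : C2) :
  c != 0 -> mact (c *: g) x = mact g x.
Proof.
move=> c0; have tZ : tilde (c *: g) = c *: tilde g.
  by rewrite /tilde -scalemxAr -!scalemxAl.
rewrite /mact tZ -scalemxAl; move: (tilde g *m hcol x) => t.
by rewrite 3![(c *: t) _ _]mxE -!mulf_div divff // !mul1r.
Qed.

Lemma mact_eqmodZ (g h : isomF R) (x : C2) :
  eqmodZ g h -> mact (val g) x = mact (val h) x.
Proof.
move=> /eqmodZP[n ->]; apply/esym/mactZ.
apply: contra_eq_neq (congr1 (fun z => z ^+ n) (@zeta12 R)) => z0.
by rewrite exprAC z0 expr0n expr1n eq_sym oner_neq0.
Qed.

Lemma act_coset (g : isomF R) (x : C2) : act (coset_Z g) x = mact (val g) x.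
Proof. exact/mact_eqmodZ/eqmodZ_repr. Qed.

Lemma act_ball (a : Gamma R) (x : C2) : unit_ball x -> unit_ball (act a x).
Proof. exact/mact_ball/isomF_prop. Qed.

Lemma actM (a b : Gamma R) (x : C2) : unit_ball x -> act (a * b)%g x = act a (act b x).
Proof.
move=> xB; rewrite -(coset_Z_repr a) -(coset_Z_repr b) -coset_ZM !act_coset.
exact: mactM (isomF_prop _) (isomF_prop _) xB.
Qed.

Definition elt_u : Gamma R := coset_Z (IsomF u_unitaryF).
Definition elt_v : Gamma R := coset_Z (IsomF v_unitaryF).
Definition elt_b : Gamma R := coset_Z (IsomF b_unitaryF).

Local Open Scope group_scope.

Definition groupK : set (Gamma R) :=
  smallest (fun H : set (Gamma R) => group_closed [in H]) [set elt_u; elt_v].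

Definition gamma3 : Gamma R := elt_b * elt_u^-1 * elt_b.

Definition double_cosetK (g : Gamma R) : set (Gamma R) :=
  [set k * g * k' | k in groupK & k' in groupK].

Definition setS : set (Gamma R) :=
  groupK `|` double_cosetK elt_b `|` double_cosetK gamma3.

Local Close Scope group_scope.

Definition dirichlet (S : set (Gamma R)) : set C2 :=
  [set x | unit_ball x /\
           forall g : Gamma R, S g -> hdist 0 x <= hdist (act g 0) x].

(* The supremum is taken in \bar R: the real-valued sup is 0 on unbounded
   sets. *)
Definition r0 : \bar R := ereal_sup [set (hdist x 0)%:E | x in dirichlet setS].

End Ball.

(* Main.v *)
(** Write t = sqrt 3 and s^2 = t - 1. In the ball K acts linearly, generated by
    u : p |-> c (p1 + p2, i (p1 - p2)), with c = zeta^2 (1 + i) / 2, and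
    v : p |-> (i p1, p2), so that u^3 = v^4 = 1 and (uv)^2 is the scalar zeta.
    The orbit K b.0 consists of the 72 points s zeta^n q, where q runs over
    unit vectors above the six vertices of an octahedron in CP^1, and |g.0| is
    constant on each of K b K and K gamma3 K. The condition d(0,x) <= d(p,x)
    reads |1 - <p,x>|^2 >= 1 - |p|^2.

    Upper bound: for fixed q, the twelve open discs |1 - zeta^n w|^2 < 2 - t
    cover the annulus 2 - t < |w|^2 <= 1, so the conditions for b force
    |<q,x>|^2 <= (2 - t) / (t - 1). In terms of the Hopf image (A, B, D) of x,
    with A^2 + B^2 + D^2 = |x|^4, this bounds |x|^2 + max(|A|, |B|, |D|), hence
    |x|^2 (1 + 1/t), and gives |x|^2 <= 2 t - 3.

    Lower bound: the bound is attained at a point above a vertex of the dual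
    cube; the conditions for gamma3 hold on the whole ball |x|^2 <= 2 t - 3. *)

Require Import Defs.
From mathcomp Require Import all_boot all_order all_algebra.
From mathcomp Require Import complex.
From mathcomp Require Import ring lra.
From mathcomp Require Import all_classical all_reals all_analysis.

Set Implicit Arguments.
Unset Strict Implicit.
Unset Printing Implicit Defensive.

Import Order.TTheory GRing.Theory Num.Theory.

Local Open Scope classical_set_scope.
Local Open Scope complex_scope.
Local Open Scope ring_scope.

Local Ltac entrywise := apply/matrixP; move=> [[|[|[|//]]] ?] [[|[|[|//]]] ?];
  rewrite ?mxE ?big_ord_recl ?big_ord0 ?mxE ?big_ord_recl ?big_ord0 ?mxE /=.

(** * Hyperbolic distance from the origin and bisector inequalities *)

Section HyperbolicDistance.
Context {R : realType}.
Local Notation C := R[i].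
Local Notation C2 := (C * C)%type.
Implicit Types (y z : R) (p q x : C2).

Lemma sqrtr_sqrB1_ge0 y : 1 <= y -> 0 <= y ^+ 2 - 1.
Proof. by move=> y1; rewrite subr_ge0 expr_ge1 //; lra. Qed.

Lemma ler_arcosh y z : 1 <= y -> 1 <= z -> (arcosh y <= arcosh z) = (y <= z).
Proof.
move=> y1 z1; have yz w w' : 1 <= w -> w < w' -> arcosh w < arcosh w'.
  move=> w1 ww'; have s0 := sqrtr_ge0 (w ^+ 2 - 1).
  have : Num.sqrt (w ^+ 2 - 1) <= Num.sqrt (w' ^+ 2 - 1).
    by apply: ler_wsqrtr; rewrite lerD2r ler_sqr ?nnegrE; lra.
  move=> le; rewrite ltr_ln ?posrE; lra.
have [ley|lty] := leP y z.
  by have [->|ne] := eqVneq y z; [rewrite lexx|rewrite ltW // yz // lt_neqAle ne].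
by rewrite leNgt yz.
Qed.

(** With s^2 = y^2 - 1, squaring y + s inside the logarithm gives (2 y^2 - 1) + 2 y s, and 2 y s is
    the root belonging to the doubled argument. *)
Lemma double_arcosh y : 1 <= y -> 2 * arcosh y = arcosh (2 * y ^+ 2 - 1).
Proof.
move=> y1; rewrite /arcosh; set s := Num.sqrt (y ^+ 2 - 1).
have s0 : 0 <= s := sqrtr_ge0 _.
have s2 : s ^+ 2 = y ^+ 2 - 1 by rewrite sqr_sqrtr // sqrtr_sqrB1_ge0.
have -> : (2 * y ^+ 2 - 1) ^+ 2 - 1 = (2 * y * s) ^+ 2.
  by rewrite [RHS]exprMn s2; ring.
rewrite sqrtr_sqr ger0_norm; last by rewrite !mulr_ge0 //; lra.
rewrite mulr_natl -lnXn; last by lra.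
by congr ln; rewrite sqrrD s2; ring.
Qed.

Lemma normc_ge0 (w : C) : 0 <= Normc.normc w.
Proof. by case: w => a b /=; rewrite sqrtr_ge0. Qed.

Lemma sqnorm_ge0 p : 0 <= sqnorm p.
Proof. by rewrite sqnormE addr_ge0 ?sqr_ge0. Qed.

Lemma sqnorm0 : sqnorm (0 : C2) = 0.
Proof. by rewrite sqnormE Normc.normc0 expr0n /= addr0. Qed.

Lemma sqnorm0_eq0 p : sqnorm p = 0 -> p = 0.
Proof.
rewrite sqnormE => /eqP; rewrite paddr_eq0 ?sqr_ge0 // !sqrf_eq0.
case: p => a b /= /andP[/eqP/Normc.eq0_normc -> /eqP/Normc.eq0_normc ->].
by [].
Qed.

Lemma unit_ball0 : unit_ball (0 : C2).
Proof. by rewrite /unit_ball /= sqnorm0. Qed.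

Lemma herm0 x : herm 0 x = 0.
Proof. by rewrite /herm /= !mul0r addr0. Qed.

Lemma hdistC p x : hdist p x = hdist x p.
Proof.
rewrite /hdist [(1 - sqnorm p) * _]mulrC; congr (arcosh (_ / _)).
case: p x => -[a b] [c d] [[a' b'] [c' d']]; rewrite /herm /=.
congr Num.sqrt; ring.
Qed.

Lemma normc_herm p x : Normc.normc (herm p x) ^+ 2 <= sqnorm p * sqnorm x.
Proof.
rewrite -subr_ge0 !sqnormE !Defs.sqr_normc.
case: p x => -[a b] [c d] [[a' b'] [c' d']] /=.
(* Lagrange's identity. *)
rewrite [leRHS](_ : _ = (a * c' - b * d' - (c * a' - d * b')) ^+ 2
   + (a * d' + b * c' - (c * b' + d * a')) ^+ 2); last by ring.
by rewrite addr_ge0 ?sqr_ge0.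
Qed.

(** Triangle inequality 1 <= |1 - w| + |w|. It settles every bisector condition in which the phase
    of w does not matter. *)
Lemma normc_1B_ge (m : R) (w : C) : m <= 1 -> 0 <= m ->
  Normc.normc w ^+ 2 <= m ^+ 2 -> (1 - m) ^+ 2 <= Normc.normc (1 - w) ^+ 2.
Proof.
move=> m1 m0; move=> wm; have {}wm : Normc.normc w <= m.
  by rewrite -(@ler_pXn2r _ 2) ?nnegrE ?normc_ge0.
have := le_normcD (1 - w) w; rewrite subrK Normc.normc1 => le1.
rewrite ler_pXn2r ?nnegrE ?normc_ge0 //; lra.
Qed.

Lemma double_hdist0 x : unit_ball x ->
  2 * hdist x 0 = arcosh ((1 + sqnorm x) / (1 - sqnorm x)).
Proof.
rewrite /unit_ball /= => xB; have x0 := sqnorm_ge0 x.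
rewrite hdistC /hdist herm0 subr0 Normc.normc1 sqnorm0 subr0 !mul1r.
rewrite double_arcosh; last first.
  rewrite invf_ge1 ?sqrtr_gt0; last by lra.
  by rewrite -[leRHS]sqrtr1 ler_wsqrtr //; lra.
congr arcosh; rewrite exprVn sqr_sqrtr; last by lra.
by field; lra.
Qed.

(** [arcosh] is increasing, and the factor 1 - |x|^2 is common to both squared arguments, so it
    cancels. *)
Lemma le_hdist0 p x : unit_ball p -> unit_ball x ->
  (hdist 0 x <= hdist p x) = (1 - sqnorm p <= Normc.normc (1 - herm p x) ^+ 2).
Proof.
move=> pB xB; have /andP[p0 le] := hdist_ball pB xB.
have /andP[p1 le1] := hdist_ball unit_ball0 xB.
have arg1 q : unit_ball q -> 1 <= Normc.normc (1 - herm q x)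
    / Num.sqrt ((1 - sqnorm q) * (1 - sqnorm x)).
  move=> qB; have /andP[q0 leq] := hdist_ball qB xB.
  rewrite ler_pdivlMr ?sqrtr_gt0 // mul1r.
  by rewrite -(@ler_pXn2r _ 2) ?nnegrE ?sqrtr_ge0 ?normc_ge0 // sqr_sqrtr // ltW.
rewrite /hdist ler_arcosh ?arg1 //; last exact: unit_ball0.
rewrite -(@ler_pXn2r _ 2) ?nnegrE ?divr_ge0 ?sqrtr_ge0 ?normc_ge0 //.
rewrite !expr_div_n (sqr_sqrtr (ltW p0)) (sqr_sqrtr (ltW p1)).
rewrite herm0 subr0 Normc.normc1 sqnorm0 subr0 mul1r expr1n div1r.
have x1 : 0 < 1 - sqnorm x by rewrite subr_gt0.
have p1' : 0 < 1 - sqnorm p by rewrite subr_gt0.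
rewrite ler_pdivlMr ?mulr_gt0 // [(1 - sqnorm p) * _]mulrC mulrA mulVf ?mul1r //.
by rewrite gt_eqF.
Qed.

End HyperbolicDistance.

(** * The generators of K in ball coordinates *)

Section StabilizerAction.
Context {R : realType}.
Local Notation C := R[i].
Local Notation C2 := (C * C)%type.
Local Notation z := (@zeta R).
Local Notation t := (Num.sqrt 3 : R).
Local Notation s := ((Num.sqrt (t - 1))%:C).
Implicit Types (p q x : C2).

Lemma sqr_sqrt3 : t ^+ 2 = 3.
Proof. by rewrite sqr_sqrtr. Qed.

Lemma sqrt3_bounds : 17 / 10 < t < 18 / 10.
Proof.
have t0 : 0 <= t := sqrtr_ge0 _; have t2 := sqr_sqrt3.
by apply/andP; split; rewrite -(@ltr_pXn2r _ 2) ?nnegrE ?t2 //; lra.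
Qed.

Lemma zeta3 : z ^+ 3 = 'i.
Proof.
have t2 := sqr_sqrt3; rewrite zetaE !exprS expr0; simpc.
by congr (_ +i* _); field: t2.
Qed.

Lemma normc_zeta : Normc.normc z ^+ 2 = 1.
Proof. by rewrite Defs.sqr_normc /= cos2Dsin2. Qed.

Lemma normc_zetaX n : Normc.normc (z ^+ n) ^+ 2 = 1.
Proof.
elim: n => [|n IHn]; first by rewrite Normc.normc1 expr1n.
by rewrite (exprS z) Normc.normcM exprMn normc_zeta IHn mulr1.
Qed.

Definition ucoef : C := z ^+ 2 * (1 + z ^+ 3) / 2.

Lemma normc_ucoef : Normc.normc ucoef ^+ 2 = 1 / 2.
Proof.
rewrite /ucoef -mulrA Normc.normcM exprMn normc_zetaX mul1r zeta3.
have -> : 2^-1 = (2^-1)%:C :> C by rewrite fmorphV rmorph_nat.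
by rewrite Defs.sqr_normc; simpc => /=; field.
Qed.

Definition fu p : C2 := (ucoef * (p.1 + p.2), ucoef * z ^+ 3 * (p.1 - p.2)).
Definition fv p : C2 := (z ^+ 3 * p.1, p.2).

Definition tildeu : 'M[C]_3 :=
  mx3 [:: [:: ucoef; ucoef; 0];
          [:: ucoef * z ^+ 3; - (ucoef * z ^+ 3); 0];
          [:: 0; 0; 1]].

Definition tildev : 'M[C]_3 :=
  mx3 [:: [:: z ^+ 3; 0; 0]; [:: 0; 1; 0]; [:: 0; 0; 1]].

(** Replaces the inverses in [tilde] by an intertwining relation, which can be checked entrywise as
    polynomial identities. *)
Lemma tilde_eq (g m : 'M[C]_3) :
  m *m (diagD *m gamma0) = diagD *m gamma0 *m g -> tilde g = m.
Proof.
move=> E; rewrite /tilde -E !mulmxA mulmxK ?unitmx_gamma0 //.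
by rewrite mulmxK ?unitmx_D.
Qed.

Lemma mul_mx3 (a b c d e f g h i a' b' c' d' e' f' g' h' i' : C) :
  mx3 [:: [:: a; b; c]; [:: d; e; f]; [:: g; h; i]] *m
  mx3 [:: [:: a'; b'; c']; [:: d'; e'; f']; [:: g'; h'; i']] =
  mx3 [:: [:: a * a' + b * d' + c * g'; a * b' + b * e' + c * h';
              a * c' + b * f' + c * i'];
          [:: d * a' + e * d' + f * g'; d * b' + e * e' + f * h';
              d * c' + e * f' + f * i'];
          [:: g * a' + h * d' + i * g'; g * b' + h * e' + i * h';
              g * c' + h * f' + i * i']].
Proof. by entrywise; rewrite addr0 addrA. Qed.

Lemma mx3_eq (a b c d e f g h i a' b' c' d' e' f' g' h' i' : C) :
  a = a' -> b = b' -> c = c' -> d = d' -> e = e' -> f = f' ->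
  g = g' -> h = h' -> i = i' ->
  mx3 [:: [:: a; b; c]; [:: d; e; f]; [:: g; h; i]] =
  mx3 [:: [:: a'; b'; c']; [:: d'; e'; f']; [:: g'; h'; i']].
Proof. by do 9!move=> ->. Qed.

Lemma diagD_gamma0 : diagD *m gamma0 =
  mx3 [:: [:: 1; 0; 0]; [:: 1; 1 - rr; 0]; [:: 0; 0; s]] :> 'M[C]_3.
Proof. by rewrite /diagD /gamma0 mul_mx3; apply: mx3_eq; ring. Qed.

Lemma tilde_u : tilde u_mx = tildeu.
Proof.
have z4 := @zeta4 R; apply: tilde_eq; rewrite diagD_gamma0 rr_zeta !mul_mx3 /ucoef.
by apply: mx3_eq; field: z4.
Qed.

Lemma tilde_v : tilde v_mx = tildev.
Proof.
have z4 := @zeta4 R; apply: tilde_eq; rewrite diagD_gamma0 rr_zeta !mul_mx3.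
by apply: mx3_eq; ring: z4.
Qed.

(** The origin lifts to [s^-1] times the image of the third basis vector under [diagD *m gamma0], so
    g.0 is read off the third column of g. *)
Lemma tilde_col2 (g : 'M[C]_3) :
  tilde g *m hcol 0 = s^-1 *: (diagD *m gamma0 *m col 2 g).
Proof.
have s0 : s != 0 by rewrite fmorph_eq0 gt_eqF ?sqrtD_gt0.
apply: (scalerI s0); rewrite scalerA divff // scale1r scalemxAr.
have -> : s *: hcol (0 : C2) = diagD *m gamma0 *m col 2 (1%:M : 'M[C]_3).
  by rewrite diagD_gamma0; entrywise; ring.
have E : tilde g *m (diagD *m gamma0) = diagD *m gamma0 *m g.
  exact: conj_mx_comm unitmx_gamma0 unitmx_D.
by rewrite mulmxA E -!mulmxA !colE mul1mx.
Qed.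

End StabilizerAction.

(** * Linear action of K, and the norms of b.0 and gamma3.0 *)

Section KOrbits.
Context {R : realType}.
Local Notation C := R[i].
Local Notation C2 := (C * C)%type.
Local Notation z := (@zeta R).
Local Notation t := (Num.sqrt 3 : R).
Local Notation s := ((Num.sqrt (t - 1))%:C).
Implicit Types (p q x : C2).

Lemma act_u p : unit_ball p -> act elt_u p = fu p.
Proof.
move=> pB; rewrite act_coset; apply/(mactP _ u_unitaryF pB); exists 1.
by rewrite /= tilde_u; entrywise; ring.
Qed.

Lemma act_v p : unit_ball p -> act elt_v p = fv p.
Proof.
move=> pB; rewrite act_coset; apply/(mactP _ v_unitaryF pB); exists 1.
by rewrite /= tilde_v; entrywise; ring.
Qed.

Lemma fu3 p : fu (fu (fu p)) = p.
Proof.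
have z4 := @zeta4 R; case: p => a b; rewrite /fu /ucoef.
by congr (_, _) => /=; field: z4.
Qed.

Lemma fv4 p : fv (fv (fv (fv p))) = p.
Proof. by have z4 := @zeta4 R; case: p => a b; rewrite /fv /=; congr (_, _); ring: z4. Qed.

Lemma fuv2 p : fu (fv (fu (fv p))) = (z * p.1, z * p.2).
Proof.
have z4 := @zeta4 R; case: p => a b; rewrite /fu /fv /ucoef.
by congr (_, _) => /=; field: z4.
Qed.

Lemma sqnormZ (w : C) p : sqnorm (w * p.1, w * p.2) = Normc.normc w ^+ 2 * sqnorm p.
Proof. by rewrite !sqnormE !Normc.normcM !exprMn mulrDr. Qed.

Lemma sqnorm_fu p : sqnorm (fu p) = sqnorm p.
Proof.
have -> : fu p = (ucoef * (p.1 + p.2, z ^+ 3 * (p.1 - p.2)).1,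
                  ucoef * (p.1 + p.2, z ^+ 3 * (p.1 - p.2)).2).
  by rewrite /fu /= mulrA.
rewrite sqnormZ normc_ucoef !sqnormE /= Normc.normcM exprMn normc_zetaX mul1r.
by rewrite !Defs.sqr_normc; case: p => -[a b] [c d] /=; field.
Qed.

Lemma sqnorm_fv p : sqnorm (fv p) = sqnorm p.
Proof. by rewrite !sqnormE /= Normc.normcM exprMn normc_zetaX mul1r. Qed.

Lemma gamma_entry (g : 'M[C]_3) : (tilde g *m hcol 0) 2 0 = g 2 2.
Proof.
have s0 : s != 0 by rewrite fmorph_eq0 gt_eqF ?sqrtD_gt0.
rewrite tilde_col2 diagD_gamma0 !mxE !big_ord_recl big_ord0 !mxE /=.
rewrite !mul0r !add0r addr0 mulKf //; congr (g _ _); exact/val_inj.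
Qed.

(** [tilde g] preserves the form J, whose value on the lift of 0 is -1; dividing by the square
    modulus of the last coordinate [g 2 2] gives |g.0|^2 - 1. *)
Lemma sqnorm_mact0 (g : 'M[C]_3) : g \in unitaryF ->
  sqnorm (mact g 0) = 1 - (Normc.normc (g 2 2) ^+ 2)^-1.
Proof.
move=> gU; have E := tilde_sqnorm 0 gU; have n0 := tilde_neq0 gU unit_ball0.
rewrite sqnorm0 /= gamma_entry in E; rewrite gamma_entry in n0.
rewrite sqnormE /mact /= gamma_entry !Normc.normcM !Normc.normcV !exprMn !exprVn.
have : Normc.normc (g 2 2) ^+ 2 != 0.
  by rewrite sqrf_eq0; apply: contra n0 => /eqP /Normc.eq0_normc ->.
move: E; move: (Normc.normc (g 2 2) ^+ 2) => m E m0.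
rewrite -mulrDl; apply: (mulIf m0); rewrite mulfVK // mulrBl mulVf //.
by move: E; lra.
Qed.

Definition ptb : C2 := (0, s * z ^+ 3).

Lemma act_b0 : act elt_b 0 = ptb.
Proof.
have z4 := @zeta4 R; have s0 : s != 0 by rewrite fmorph_eq0 gt_eqF ?sqrtD_gt0.
rewrite act_coset; apply/(mactP _ b_unitaryF unit_ball0).
(* The projective multiplier is the last entry of [b_mx], by [gamma_entry]. *)
exists (- z ^+ 3 + z + 1); rewrite /= tilde_col2 diagD_gamma0.
apply: (scalerI s0); rewrite scalerA divff // scale1r.
have s2 := @sqr_sqrtD R; rewrite rr_zeta in s2.
by entrywise; rewrite ?rr_zeta; ring: z4 s2.
Qed.

Lemma u_mx3 : u_mx *m u_mx *m u_mx = 1%:M :> 'M[C]_3.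
Proof. by have z4 := @zeta4 R; entrywise; ring: z4. Qed.

Lemma sqnorm_gamma3 : sqnorm (act gamma3 (0 : C2)) = t / 2.
Proof.
set g := (IsomF b_unitaryF * (IsomF u_unitaryF)^-1 * IsomF b_unitaryF)%g : isomF R.
have -> : gamma3 = coset_Z g by rewrite /gamma3 !coset_ZM coset_ZV.
rewrite act_coset sqnorm_mact0; last exact: isomF_prop.
have -> : val g 2 2 = 1 + rr.
  (* Since u has order 3 as a matrix, [u^-1] is [u *m u] and the entry becomes a polynomial in
     [zeta]. *)
  have -> : val g = b_mx *m (u_mx *m u_mx) *m b_mx.
    rewrite /g /=; congr (_ *m _ *m _); rewrite -[LHS]mul1mx -u_mx3.
    by rewrite mulmxK //; have [] := unitaryF_inv (@u_unitaryF R).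
  have z4 := @zeta4 R.
  by rewrite ?mxE ?big_ord_recl ?big_ord0 ?mxE ?big_ord_recl ?big_ord0 ?mxE
    ?big_ord_recl ?big_ord0 ?mxE ?big_ord_recl ?big_ord0 ?mxE /= rr_zeta; ring: z4.
have /andP[tl tu] := @sqrt3_bounds R; have t2 := @sqr_sqrt3 R.
rewrite rrE Defs.sqr_normc /= addr0 expr0n /= addr0.
by field: t2; rewrite gt_eqF //; nra.
Qed.

End KOrbits.

(** * Covering an annulus by discs, and the octahedral estimate *)

Section UpperBound.
Context {R : realType}.
Local Notation C := R[i].
Local Notation C2 := (C * C)%type.
Local Notation z := (@zeta R).
Local Notation t := (Num.sqrt 3 : R).
Local Notation s := ((Num.sqrt (t - 1))%:C).
Implicit Types (p q x : C2).

Lemma normc_rotate_bound (w : C) :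
  (forall n, 2 - t <= Normc.normc (1 - z ^+ n * w) ^+ 2) ->
  Normc.normc w ^+ 2 <= 1 -> Normc.normc w ^+ 2 <= 2 - t.
Proof.
have /andP[tl tu] := @sqrt3_bounds R; have t2 := @sqr_sqrt3 R.
move=> H w1; have normw n : Normc.normc (z ^+ n * w) ^+ 2 = Normc.normc w ^+ 2.
  by rewrite Normc.normcM exprMn normc_zetaX mul1r.
(* Here 2 - t = tan(pi / 12), so the claim puts some rotate of w in the sector |arg| <= pi / 12. *)
suff [n /andP[bl bu]] : exists n, - ((2 - t) * complex.Re (z ^+ n * w))
    <= complex.Im (z ^+ n * w) <= (2 - t) * complex.Re (z ^+ n * w).
  have := H n; rewrite -(normw n) in w1 *; move: w1 bl bu.
  rewrite !Defs.sqr_normc; case: (z ^+ n * w) => a b /= w1 bl bu Hn.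
  have a0 : 0 <= a by nra.
  have b2 : b ^+ 2 <= ((2 - t) * a) ^+ 2 by nra.
  (* In the sector, with rho = |w|, [Hn] yields rho^2 - 2 rho cos(pi / 12) + t - 1 >= 0. The roots
     are sqrt(2 - t) and sqrt 2, so 2 - t < rho^2 <= 1 is impossible. *)
  rewrite leNgt; apply/negP => lt; nra.
(* A rotation by a power of i puts w in the quadrant |Im| <= Re, and a further
   rotation by -30, 0 or 30 degrees in the sector |arg| <= 15 degrees. *)
have [k /andP[kl ku]] : exists k, - complex.Re (z ^+ k * w)
    <= complex.Im (z ^+ k * w) <= complex.Re (z ^+ k * w).
  have z6 : z ^+ 6 = -1 by rewrite (exprM _ 3 2) zeta3 sqr_i.
  have z9 : z ^+ 9 = - 'i by rewrite (exprD _ 6 3) z6 zeta3 mulN1r.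
  case: w {H w1 normw} => a b.
  have [ab|ab] := leP a b; have [nab|nab] := leP (- a) b.
  - by exists 9; rewrite z9; simpc => /=; apply/andP; split; lra.
  - by exists 6; rewrite z6; simpc => /=; apply/andP; split; lra.
  - by exists 0%N; rewrite expr0 mul1r /=; apply/andP; split; lra.
  - by exists 3; rewrite zeta3; simpc => /=; apply/andP; split; lra.
have zk : z = (t / 2) +i* (1 / 2) := zetaE.
have [b1|b1] := leP (complex.Im (z ^+ k * w)) ((2 - t) * complex.Re (z ^+ k * w)).
  have [b2|b2] := leP (- ((2 - t) * complex.Re (z ^+ k * w)))
                      (complex.Im (z ^+ k * w)).
    by exists k; rewrite b1 b2.
  exists k.+1; rewrite exprS -mulrA.
  move: kl ku b1 b2; rewrite zk; case: (_ ^+ k * w) => a b /= kl ku b1 b2.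
  apply/andP; split; nra.
exists (11 + k)%N; rewrite exprD -mulrA.
have -> : z ^+ 11 = (t / 2) -i* (1 / 2).
  have z0 : z != 0 by apply: contra_eq_neq (@zeta12 R) => ->; rewrite expr0n eq_sym oner_neq0.
  by apply: (mulfI z0); rewrite -exprS zeta12 zk; simpc; congr (_ +i* _); field: t2.
move: kl ku b1; rewrite zk; case: (_ ^+ k * w) => a b /= kl ku b1.
apply/andP; split; nra.
Qed.

(** For a unit vector q above a vertex of the octahedron, 2 |<q,x>|^2 is |x|^2 plus or minus one
    Hopf coordinate. The vectors (i^n, 1) have square norm 2, whence [2 * m]. *)
Lemma octahedral_bound x (m : R) :
  Normc.normc (herm (1, 0) x) ^+ 2 <= m ->
  Normc.normc (herm (0, 1) x) ^+ 2 <= m ->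
  (forall n, Normc.normc (herm (z ^+ (3 * n), 1) x) ^+ 2 <= 2 * m) ->
  sqnorm x * (1 + t) <= 2 * t * m.
Proof.
have /andP[tl tu] := @sqrt3_bounds R; have t2 := @sqr_sqrt3 R.
move=> ax0 ax1 Hdiag.
have z6 : z ^+ 6 = -1 by rewrite (exprM _ 3 2) zeta3 sqr_i.
have z9 : z ^+ 9 = - 'i by rewrite (exprD _ 6 3) z6 zeta3 mulN1r.
move: ax0 ax1.
have := Hdiag 0%N; have := Hdiag 1%N; have := Hdiag 2; have := Hdiag 3.
rewrite /= expr0 zeta3 z6 z9 sqnormE !Defs.sqr_normc /herm.
case: x {Hdiag} => -[a b] [c d] /=.
rewrite !(mul0r, mul1r, mulN1r, mulr1, mulr0, add0r, addr0, subr0, opprK, mulrN, oppr0).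
move=> h3 h2 h1 h0 ha0 ha1.
pose A := a ^+ 2 + b ^+ 2 - (c ^+ 2 + d ^+ 2).
pose B := 2 * (a * c + b * d); pose D := 2 * (a * d - b * c).
pose N := a ^+ 2 + b ^+ 2 + (c ^+ 2 + d ^+ 2).
have E : A ^+ 2 + B ^+ 2 + D ^+ 2 = N ^+ 2 by rewrite /A /B /D /N; ring.
have sqb e : N + e <= 2 * m -> N - e <= 2 * m -> e ^+ 2 <= (2 * m - N) ^+ 2.
  by move=> e1 e2; nra.
have hA : A ^+ 2 <= (2 * m - N) ^+ 2 by apply: sqb; rewrite /A /N; lra.
have hB : B ^+ 2 <= (2 * m - N) ^+ 2 by apply: sqb; rewrite /B /N; nra.
have hD : D ^+ 2 <= (2 * m - N) ^+ 2 by apply: sqb; rewrite /D /N; nra.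
rewrite -/N.
have N0 : 0 <= N by rewrite /N; nra.
have mN : 0 <= 2 * m - N by move: h1 h3; rewrite /N; nra.
(* The three coordinate bounds add up to N^2 <= 3 (2 m - N)^2. *)
have : N <= t * (2 * m - N).
  rewrite -(@ler_pXn2r _ 2) ?nnegrE // ?mulr_ge0 ?sqrtr_ge0 //.
  by rewrite exprMn t2; lra.
by move: (N) => n; lra.
Qed.

End UpperBound.

(** * Norm bound on the Dirichlet domain from the orbit K b.0 *)

Section DirichletUpper.
Context {R : realType}.
Local Notation C := R[i].
Local Notation C2 := (C * C)%type.
Local Notation z := (@zeta R).
Local Notation t := (Num.sqrt 3 : R).
Local Notation s := ((Num.sqrt (t - 1))%:C).
Implicit Types (p q x : C2).

Lemma groupK_u : groupK (elt_u : Gamma R).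
Proof. by move=> A /= [_ sA]; apply: sA; left. Qed.

Lemma groupK_v : groupK (elt_v : Gamma R).
Proof. by move=> A /= [_ sA]; apply: sA; right. Qed.

Lemma groupK1 : groupK (1%g : Gamma R).
Proof. by move=> A /= [[A1 _] _]; rewrite -in_setE. Qed.

Lemma groupKM (k l : Gamma R) : groupK k -> groupK l -> groupK (k * l)%g.
Proof.
move=> Kk Kl A AP; move: (AP) => /= [Ag _]; rewrite -in_setE.
by apply: (group_closedM Ag); apply/mem_set; [apply: Kk|apply: Kl].
Qed.

Lemma act1 p : unit_ball p -> act (1%g : Gamma R) p = p.
Proof.
move=> pB; rewrite -[1%g]/(coset_Z 1%g) act_coset.
apply/(mactP _ (isomF_prop _) pB); exists 1; rewrite scale1r.
by rewrite (@tilde_eq _ _ 1%:M) ?mul1mx // mulmx1.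
Qed.

(** Group closure is tested on [k * l^-1]. An equivalence passes to [l^-1] by applying it at the
    point [act l^-1 p]; a mere implication would not. *)
Lemma groupK_invariant (P : set C2) :
  (forall p, P (fu p) <-> P p) -> (forall p, P (fv p) <-> P p) ->
  forall k : Gamma R, groupK k -> forall p, unit_ball p -> P (act k p) <-> P p.
Proof.
move=> Pu Pv.
suff : groupK `<=` [set k : Gamma R | forall p, unit_ball p -> P (act k p) <-> P p].
  by move=> sub k /sub.
apply: smallest_sub; last first.
  by move=> _ [|] -> p pB; rewrite ?act_u ?act_v.
split=> [|k l /set_mem kP /set_mem lP]; apply/mem_set => p pB /=.
  by rewrite act1.
have lB : unit_ball (act l^-1%g p) by apply: act_ball.
by rewrite (actM _ _ pB) (kP _ lB) -{2}(act1 pB) -(mulgV l) (actM _ _ pB) (lP _ lB).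
Qed.

Lemma sqnorm_groupK (k : Gamma R) p :
  groupK k -> unit_ball p -> sqnorm (act k p) = sqnorm p.
Proof.
move=> Kk pB; pose P : set C2 := [set q | sqnorm q = sqnorm p].
have [||_ ->//] := @groupK_invariant P _ _ k Kk p pB => // q.
- by rewrite /P /= sqnorm_fu.
- by rewrite /P /= sqnorm_fv.
Qed.

Lemma groupK_fix0 (k : Gamma R) : groupK k -> act k (0 : C2) = 0.
Proof.
move=> Kk; apply: sqnorm0_eq0; rewrite sqnorm_groupK ?sqnorm0 //.
exact: unit_ball0.
Qed.

Lemma normc_s : Normc.normc s ^+ 2 = t - 1.
Proof.
have /andP[tl tu] := @sqrt3_bounds R.
by rewrite Defs.sqr_normc /= expr0n addr0 sqr_sqrtr //; lra.
Qed.

Lemma sqnorm_ptb : sqnorm (@ptb R) = t - 1.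
Proof.
rewrite sqnormE (_ : ptb.1 = 0) // Normc.normc0 expr0n add0r Normc.normcM exprMn.
by rewrite normc_zetaX mulr1 normc_s.
Qed.

Lemma unit_ball_ptb : unit_ball (@ptb R).
Proof. by have /andP[tl tu] := @sqrt3_bounds R; rewrite /unit_ball /= sqnorm_ptb; lra. Qed.

Definition orbit_b : set C2 := [set act k ptb | k in @groupK R].

Lemma orbit_b_ball p : orbit_b p -> unit_ball p.
Proof. by move=> [k _ <-]; apply/act_ball/unit_ball_ptb. Qed.

Lemma orbit_b_fu p : orbit_b p -> orbit_b (fu p).
Proof.
move=> Tp; have pB := orbit_b_ball Tp; case: Tp => k Kk kp.
exists (elt_u * k)%g; first exact: groupKM groupK_u Kk.
by rewrite actM ?kp ?act_u //; apply: unit_ball_ptb.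
Qed.

Lemma orbit_b_fv p : orbit_b p -> orbit_b (fv p).
Proof.
move=> Tp; have pB := orbit_b_ball Tp; case: Tp => k Kk kp.
exists (elt_v * k)%g; first exact: groupKM groupK_v Kk.
by rewrite actM ?kp ?act_v //; apply: unit_ball_ptb.
Qed.

Lemma orbit_b_zeta n p : orbit_b p -> orbit_b (z ^+ n * p.1, z ^+ n * p.2).
Proof.
move=> Tp; elim: n => [|n IHn]; first by rewrite expr0 !mul1r; case: p Tp.
by rewrite exprS -!mulrA -(fuv2 (_, _)); do 2!apply/orbit_b_fu/orbit_b_fv.
Qed.

Lemma orbit_b_ptb : orbit_b ptb.
Proof.
exists 1%g; first exact: groupK1.
by rewrite act1 //; apply: unit_ball_ptb.
Qed.

Lemma orbit_b_diag n :
  orbit_b (ucoef * s * z ^+ (3 * n), ucoef * s).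
Proof.
(* The induction starts at [fu ptb], with exponent 3, and each [fv] adds 3; the case n = 0 is
   reached as exponent 12. *)
suff D m : orbit_b (ucoef * s * z ^+ (3 * m.+1), ucoef * s).
  have := D (n + 3)%N; rewrite -addnS mulnDr (exprD _ (3 * n)).
  by rewrite (_ : z ^+ (3 * 4) = 1) ?mulr1 //; apply: zeta12.
elim: m => [|m IHm].
  have z4 := @zeta4 R.
  rewrite (_ : (_, _) = fu ptb); first exact/orbit_b_fu/orbit_b_ptb.
  by rewrite /fu /ptb /=; congr (_, _); ring: z4.
rewrite (_ : (_, _) = fv (ucoef * s * z ^+ (3 * m.+1), ucoef * s)).
  exact: orbit_b_fv.
by rewrite /fv /=; congr (_, _); rewrite (mulnS 3 m.+1) exprD; ring.
Qed.

Lemma dirichlet_orbit_b x p : dirichlet setS x -> orbit_b p ->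
  2 - t <= Normc.normc (1 - herm p x) ^+ 2.
Proof.
move=> [xB xS] Tp; have pB := orbit_b_ball Tp.
case: Tp => k Kk kp.
have := xS (k * elt_b * 1)%g; rewrite mulg1 actM ?act_b0 ?kp; last exact: unit_ball0.
rewrite le_hdist0 // -{1}kp sqnorm_groupK ?sqnorm_ptb //; last exact: unit_ball_ptb.
have -> : 1 - (t - 1) = 2 - t by ring.
apply.
left; right; exists k => //; exists 1%g; first exact: groupK1.
by rewrite mulg1.
Qed.

(** The orbit is stable under multiplication by [zeta], so all twelve rotated inequalities hold at
    once; Cauchy-Schwarz puts <p,x> in the unit disc. *)
Lemma dirichlet_herm x p : dirichlet setS x -> orbit_b p ->
  Normc.normc (herm p x) ^+ 2 <= 2 - t.
Proof.
move=> xD Tp; have [xB _] := xD; apply: normc_rotate_bound => [n|].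
  have -> : z ^+ n * herm p x = herm (z ^+ n * p.1, z ^+ n * p.2) x.
    by rewrite /herm /=; ring.
  exact/dirichlet_orbit_b/orbit_b_zeta.
apply: le_trans (normc_herm p x) _.
have := orbit_b_ball Tp; move: xB; rewrite /unit_ball /= => xB pB.
have := sqnorm_ge0 x; have := sqnorm_ge0 p; nra.
Qed.

Lemma hermZ (w : C) p x : herm (w * p.1, w * p.2) x = w * herm p x.
Proof. by rewrite /herm /=; ring. Qed.

Lemma dirichlet_sqnorm x : dirichlet setS x -> sqnorm x <= 2 * t - 3.
Proof.
move=> xD; have /andP[tl tu] := @sqrt3_bounds R; have t2 := @sqr_sqrt3 R.
have bound (w a b : C) : orbit_b (w * a, w * b) ->
    Normc.normc w ^+ 2 * Normc.normc (herm (a, b) x) ^+ 2 <= 2 - t.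
  by move=> /(dirichlet_herm xD); rewrite (hermZ w (a, b)) Normc.normcM exprMn.
(* Orbit points are s times a unit vector up to phase, and |s|^2 = t - 1. *)
pose m := (2 - t) / (t - 1).
have t1 : 0 < t - 1 by lra.
have mE : m * (t - 1) = 2 - t by rewrite divfK // gt_eqF.
(* As (t - 1) (t + 1) = 2, the bound 2 t m / (1 + t) equals t (2 - t) = 2 t - 3. *)
suff : sqnorm x * (1 + t) <= 2 * t * m by nra.
apply: octahedral_bound => [||n].
- have := @bound (ucoef * ucoef * s * 2) 1 0; rewrite mulr1 mulr0.
  rewrite 3!Normc.normcM 3!exprMn normc_ucoef normc_s.
  have -> : Normc.normc (2 : C) ^+ 2 = 4.
    by rewrite -(rmorph_nat (real_complex R)) Defs.sqr_normc /=; ring.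
  rewrite (_ : (_, 0) = fu (ucoef * s * z ^+ (3 * 0), ucoef * s)); last first.
    by rewrite /fu /= expr0; congr (_, _); ring.
  by move=> /(_ (orbit_b_fu (orbit_b_diag 0))); nra.
- have := @bound (s * z ^+ 3) 0 1; rewrite mulr0 mulr1.
  move=> /(_ orbit_b_ptb); rewrite Normc.normcM exprMn normc_zetaX mulr1 normc_s.
  by nra.
- have := @bound (ucoef * s) (z ^+ (3 * n)) 1; rewrite mulr1.
  move=> /(_ (orbit_b_diag n)); rewrite Normc.normcM exprMn normc_ucoef normc_s.
  by nra.
Qed.

End DirichletUpper.

(** * A point of the Dirichlet domain at maximal distance *)

Section DirichletLower.
Context {R : realType}.
Local Notation C := R[i].
Local Notation C2 := (C * C)%type.
Local Notation z := (@zeta R).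
Local Notation t := (Num.sqrt 3 : R).
Local Notation s := ((Num.sqrt (t - 1))%:C).
Implicit Types (p q x : C2).

(** Factors the twelve powers of [zeta] through the powers of i, giving explicit coordinates for the
    inequality checks. *)
Lemma zetaX_cases n : exists2 b : C, b \in [:: 1; z; z ^+ 2] &
  [\/ z ^+ n = b, z ^+ n = 'i * b, z ^+ n = - b | z ^+ n = - ('i * b)].
Proof.
exists (z ^+ (n %% 3)).
  have := ltn_pmod n (isT : (0 < 3)%N).
  by case: (n %% 3)%N => [|[|[|]]] // _; rewrite !inE ?expr0 ?expr1 eqxx ?orbT.
rewrite {1 3 5 7}(divn_eq n 3) exprD mulnC exprM zeta3.
elim: (n %/ 3)%N => [|m]; first by constructor 1; rewrite expr0 mul1r.
have i2 : 'i * 'i = -1 :> C by rewrite -expr2 sqr_i.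
rewrite exprS -mulrA => -[->|->|->|->].
- by constructor 2.
- by constructor 3; rewrite mulrA i2 mulN1r.
- by constructor 4; rewrite mulrN.
- by constructor 1; rewrite mulrN mulrA i2 mulN1r opprK.
Qed.

Definition y1 : C := z ^+ 3 - z ^+ 2 + 1.
Definition y2 : C := (2 - rr) * z ^+ 2.
(** The factor [s^-1] cancels the s of the orbit points, so all pairings reduce to those of
    octahedron vertices with (y1, y2). *)
Definition farthest : C2 := (s^-1 * y1, s^-1 * y2).

Lemma zeta2 : z ^+ 2 = (1 / 2) +i* (t / 2).
Proof. by have t2 := @sqr_sqrt3 R; rewrite expr2 zetaE; simpc; congr (_ +i* _); field: t2. Qed.

Lemma y1E : y1 = (1 / 2) +i* (1 - t / 2).
Proof. by rewrite /y1 zeta3 zeta2; simpc; congr (_ +i* _); field. Qed.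

Lemma rr2E : 2 - rr = (2 - t)%:C :> C.
Proof. by rewrite rrE rmorphB rmorph_nat. Qed.

(** [y1] is sqrt(2 - t) exp(i pi / 12), a common point of the circles of square radius 2 - t about 1
    and [zeta]. Equality thus holds for n = 0 and n = 11, and the phase of [farthest] matters. *)
Lemma normc_y1_rotate n : 2 - t <= Normc.normc (1 - z ^+ n * y1) ^+ 2.
Proof.
have /andP[tl tu] := @sqrt3_bounds R; have t2 := @sqr_sqrt3 R.
have [b bE] := zetaX_cases n; rewrite Defs.sqr_normc y1E.
move: bE; rewrite !inE => /or3P[]/eqP-> [] ->; rewrite ?zeta2 ?zetaE; simpc => /=; nra.
Qed.

Lemma normc_rr2_rotate n : 2 - t <= Normc.normc (1 - z ^+ n * (2 - rr)) ^+ 2.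
Proof.
have /andP[tl tu] := @sqrt3_bounds R; have t2 := @sqr_sqrt3 R.
apply: le_trans (@normc_1B_ge R (2 - t) _ _ _ _); [nra|lra|lra|].
rewrite Normc.normcM exprMn normc_zetaX mul1r rr2E Defs.sqr_normc /=.
by rewrite expr0n addr0.
Qed.

Lemma sqnorm_farthest : sqnorm farthest = 2 * t - 3.
Proof.
have /andP[tl tu] := @sqrt3_bounds R; have t2 := @sqr_sqrt3 R.
rewrite -[farthest]/(s^-1 * (y1, y2).1, s^-1 * (y1, y2).2) sqnormZ.
rewrite Normc.normcV exprVn normc_s sqnormE [(y1, y2).1]/= [(y1, y2).2]/=.
rewrite [Normc.normc y2]Normc.normcM exprMn normc_zetaX y1E rr2E !Defs.sqr_normc /=.
by field: t2; rewrite gt_eqF //; lra.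
Qed.

Lemma unit_ball_farthest : unit_ball farthest.
Proof. by have /andP[tl tu] := @sqrt3_bounds R; rewrite /unit_ball /= sqnorm_farthest; lra. Qed.

(** Unit vectors above the points 0, infinity, 1, -1, i, -i of CP^1. The factor a has modulus 1 /
    sqrt 2 and argument pi / 4; this phase, not a power of [zeta], is the one that occurs in the
    orbit. *)
Definition octahedron : seq C2 :=
  let a := (1 + z ^+ 3) / 2 in
  [:: (1, 0); (0, 1); (a, a); (a, a * z ^+ 3); (a, - a); (a, - (a * z ^+ 3))].

Definition orbit_octahedron : set C2 :=
  [set p | exists n q, q \in octahedron /\ p = (s * z ^+ n * q.1, s * z ^+ n * q.2)].

Lemma orbit_octahedron_fu p : orbit_octahedron p -> orbit_octahedron (fu p).
Proof.
have z4 := @zeta4 R.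
(* By linearity it suffices to send each vertex to a power of [zeta] times a vertex. *)
have step k q' n q : q' \in octahedron -> fu q = (z ^+ k * q'.1, z ^+ k * q'.2) ->
    orbit_octahedron (fu (s * z ^+ n * q.1, s * z ^+ n * q.2)).
  move=> q'O; rewrite /fu /= => -[E1 E2]; exists (n + k)%N, q'; split=> //.
  rewrite exprD; congr (_, _).
    by transitivity (s * z ^+ n * (z ^+ k * q'.1)); [rewrite -E1|]; ring.
  by transitivity (s * z ^+ n * (z ^+ k * q'.2)); [rewrite -E2|]; ring.
pose a : C := (1 + z ^+ 3) / 2.
move=> [n [q [qO ->]]]; move: qO; rewrite !inE.
case/or4P=> [/eqP->|/eqP->|/eqP->|/or3P[]/eqP->].
- apply: (step 2%N (a, a * z ^+ 3)); first by rewrite !inE eqxx ?orbT.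
  by rewrite /fu /ucoef /a /=; congr (_, _); field: z4.
- apply: (step 2%N (a, - (a * z ^+ 3))); first by rewrite !inE eqxx ?orbT.
  by rewrite /fu /ucoef /a /=; congr (_, _); field: z4.
- apply: (step 5%N (1, 0)); first by rewrite !inE eqxx ?orbT.
  by rewrite /fu /ucoef /a /=; congr (_, _); field: z4.
- apply: (step 5%N (a, a)); first by rewrite !inE eqxx ?orbT.
  by rewrite /fu /ucoef /a /=; congr (_, _); field: z4.
- apply: (step 8%N (0, 1)); first by rewrite !inE eqxx ?orbT.
  by rewrite /fu /ucoef /a /=; congr (_, _); field: z4.
- apply: (step 2%N (a, - a)); first by rewrite !inE eqxx ?orbT.
  by rewrite /fu /ucoef /a /=; congr (_, _); field: z4.
Qed.

Lemma orbit_octahedron_fv p : orbit_octahedron p -> orbit_octahedron (fv p).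
Proof.
have z4 := @zeta4 R.
have step k q' n q : q' \in octahedron -> fv q = (z ^+ k * q'.1, z ^+ k * q'.2) ->
    orbit_octahedron (fv (s * z ^+ n * q.1, s * z ^+ n * q.2)).
  move=> q'O; rewrite /fv /= => -[E1 E2]; exists (n + k)%N, q'; split=> //.
  rewrite exprD; congr (_, _).
    by transitivity (s * z ^+ n * (z ^+ k * q'.1)); [rewrite -E1|]; ring.
  by transitivity (s * z ^+ n * (z ^+ k * q'.2)); [rewrite -E2|]; ring.
pose a : C := (1 + z ^+ 3) / 2.
move=> [n [q [qO ->]]]; move: qO; rewrite !inE.
case/or4P=> [/eqP->|/eqP->|/eqP->|/or3P[]/eqP->].
- apply: (step 3%N (1, 0)); first by rewrite !inE eqxx ?orbT.
  by rewrite /fv /=; congr (_, _); ring: z4.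
- apply: (step 0%N (0, 1)); first by rewrite !inE eqxx ?orbT.
  by rewrite /fv /=; congr (_, _); ring: z4.
- apply: (step 3%N (a, - (a * z ^+ 3))); first by rewrite !inE eqxx ?orbT.
  by rewrite /fv /a /=; congr (_, _); field: z4.
- apply: (step 3%N (a, a)); first by rewrite !inE eqxx ?orbT.
  by rewrite /fv /a /=; congr (_, _); field: z4.
- apply: (step 3%N (a, a * z ^+ 3)); first by rewrite !inE eqxx ?orbT.
  by rewrite /fv /a /=; congr (_, _); field: z4.
- apply: (step 3%N (a, - a)); first by rewrite !inE eqxx ?orbT.
  by rewrite /fv /a /=; congr (_, _); field: z4.
Qed.

(** The converse implications asked for by [groupK_invariant] come from the orders 3 of [fu] and 4
    of [fv]. *)
Lemma orbit_b_octahedron p : orbit_b p -> orbit_octahedron p.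
Proof.
move=> [k Kk <-]; apply/(@groupK_invariant R) => //.
- move=> q; split; last exact: orbit_octahedron_fu.
  by move=> /orbit_octahedron_fu/orbit_octahedron_fu; rewrite fu3.
- move=> q; split; last exact: orbit_octahedron_fv.
  by move=> /orbit_octahedron_fv/orbit_octahedron_fv/orbit_octahedron_fv; rewrite fv4.
- exact: unit_ball_ptb.
- by exists 3, (0, 1); rewrite !inE eqxx orbT mulr1 mulr0.
Qed.

(** The three vertices of the face nearest to the cube vertex give [y1]; their antipodes give the
    smaller modulus 2 - t. *)
Lemma herm_octahedron q : q \in octahedron -> exists n,
  herm q (y1, y2) = z ^+ n * y1 \/ herm q (y1, y2) = z ^+ n * (2 - rr).
Proof.
have z4 := @zeta4 R.
have cy1 : y1^* = z ^+ 2 - z ^+ 3.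
  rewrite /y1 !(rmorphD, rmorphN, rmorphXn, rmorph1) /= conj_zeta zetaVE.
  by ring: z4.
have cy2 : y2^* = (2 - 2 * z + z ^+ 3) * (1 - z ^+ 2).
  rewrite /y2 rr_zeta !(rmorphD, rmorphN, rmorphM, rmorphXn, rmorph_nat) /=.
  by rewrite conj_zeta zetaVE; ring: z4.
rewrite /herm [(y1, y2).1]/= [(y1, y2).2]/= cy1 cy2 /y1 rr_zeta !inE.
case/or4P=> [/eqP->|/eqP->|/eqP->|/or3P[]/eqP->] /=.
- by exists 11; left; ring: z4.
- by exists 10; right; ring: z4.
- by exists 0%N; left; field: z4.
- by exists 1%N; left; field: z4.
- by exists 2; right; field: z4.
- by exists 0%N; right; field: z4.
Qed.

Lemma farthest_orbit_b p : orbit_b p ->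
  2 - t <= Normc.normc (1 - herm p farthest) ^+ 2.
Proof.
move=> /orbit_b_octahedron[n [q [qO ->]]].
have -> : herm (s * z ^+ n * q.1, s * z ^+ n * q.2) farthest
    = z ^+ n * herm q (y1, y2).
  have s0 : s != 0 by rewrite fmorph_eq0 gt_eqF ?sqrtD_gt0.
  have cs : (s^-1)^* = s^-1 by rewrite -fmorphV /=; simpc.
  rewrite hermZ /herm /farthest [(_, _).1]/= [(_, _).2]/= !rmorphM /= cs.
  by field.
have [k [->|->]] := herm_octahedron qO; rewrite mulrA -exprD.
  exact: normc_y1_rotate.
exact: normc_rr2_rotate.
Qed.

Lemma dirichlet_farthest : dirichlet setS farthest.
Proof.
have /andP[tl tu] := @sqrt3_bounds R; have t2 := @sqr_sqrt3 R.
have B0 := @unit_ball0 R; split=> [|g]; first exact: unit_ball_farthest.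
have act0 k h k' : groupK k -> groupK k' ->
    act (k * h * k')%g (0 : C2) = act k (act h 0).
  by move=> Kk Kk'; rewrite (actM _ _ B0) (groupK_fix0 Kk') (actM _ _ B0).
move=> [[Kg|]|].
- by rewrite (groupK_fix0 Kg).
- move=> [k Kk [k' Kk' <-]]; rewrite (act0 _ _ _ Kk Kk') act_b0.
  have Tp : orbit_b (act k ptb) by exists k.
  rewrite (le_hdist0 (orbit_b_ball Tp) unit_ball_farthest).
  rewrite (sqnorm_groupK Kk unit_ball_ptb) sqnorm_ptb.
  have -> : 1 - (t - 1) = 2 - t by ring.
  exact: farthest_orbit_b.
(* By Cauchy-Schwarz every point at distance r0 from 0 satisfies the gamma3
   inequalities, since the points of K gamma3.0 are at distance 2 r0. *)
move=> [k Kk [k' Kk' <-]]; rewrite (act0 _ _ _ Kk Kk').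
have gB : unit_ball (act gamma3 (0 : C2)) := act_ball _ B0.
rewrite (le_hdist0 (act_ball _ gB) unit_ball_farthest).
rewrite (sqnorm_groupK Kk gB) sqnorm_gamma3.
(* ((3 - t) / 2)^2 is exactly (t / 2) (2 t - 3), the Cauchy-Schwarz bound, and (1 - (3 - t) / 2)^2
   is exactly 1 - t / 2. *)
apply: le_trans (@normc_1B_ge R ((3 - t) / 2) _ _ _ _); [nra|lra|lra|].
apply: le_trans (normc_herm _ _) _.
rewrite (sqnorm_groupK Kk gB) sqnorm_gamma3 sqnorm_farthest; nra.
Qed.

End DirichletLower.

Theorem proposition3p2 (R : realType) :
  r0 = (2^-1 * hdist (act gamma3 0) (0 : R[i] * R[i]))%:E /\
  2^-1 * hdist (act gamma3 0) (0 : R[i] * R[i])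
    = 2^-1 * arcosh (Num.sqrt 3 + 1).
Proof.
have /andP[tl tu] := @sqrt3_bounds R; have t2 := @sqr_sqrt3 R.
set t := Num.sqrt 3 in tl tu t2 *.
have dE (x : R[i] * R[i]) : unit_ball x ->
    hdist x 0 = 2^-1 * arcosh ((1 + sqnorm x) / (1 - sqnorm x)).
  by move=> /double_hdist0 <-; rewrite mulKf.
have g3 : hdist (act gamma3 0) (0 : R[i] * R[i]) = arcosh (t + 1).
  rewrite dE; last exact: (act_ball _ unit_ball0).
  rewrite sqnorm_gamma3 -/t; apply: (canLR (mulKf _)) => //.
  (* Both arguments equal 7 + 4 t: (2 + t) / (2 - t) = (2 + t)^2 and 2 (t + 1)^2 - 1. *)
  rewrite double_arcosh; last lra.
  by congr arcosh; field: t2; rewrite gt_eqF //; lra.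
have farE : hdist (@farthest R) 0 = 2^-1 * arcosh (t + 1).
  rewrite dE; last exact: unit_ball_farthest.
  rewrite sqnorm_farthest -/t; congr (_ * arcosh _).
  by field: t2; rewrite gt_eqF //; lra.
rewrite g3; split=> //; apply/eqP; rewrite eq_le; apply/andP; split.
  apply: ge_ereal_sup => _ [x xD <-]; rewrite lee_fin -farE.
  have xs := dirichlet_sqnorm xD; have [xB _] := xD.
  have x0 := sqnorm_ge0 x.
  rewrite !dE ?sqnorm_farthest //; last exact: unit_ball_farthest.
  rewrite -/t in xs *; rewrite ler_pM2l ?invr_gt0 //.
  (* This form makes the monotonicity in u visible; the hypothesis keeps u below 1. *)
  have mono u : u <= 2 * t - 3 -> (1 + u) / (1 - u) = 2 / (1 - u) - 1.
    by move=> ?; field; rewrite gt_eqF //; lra.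
  rewrite ler_arcosh ?mono ?lexx //.
  - rewrite lerD2r ler_pM2l // lef_pV2 ?posrE; lra.
  - by rewrite -mono // ler_pdivlMr; lra.
  - by rewrite -mono // ler_pdivlMr; lra.
by apply: ereal_sup_ubound; exists farthest; [apply: dirichlet_farthest|rewrite farE].
Qed.
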